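(* Let $P$ be the transition matrix of an irreducible and reversible Markov chain on a finite state space $\Omega$ with $|\Omega|\ge 2$, with stationary distribution $\pi$, and assume $P$ is transitive. Let $X=(X_t)_{t\ge0}$ and $Y=(Y_t)_{t\ge0}$ be independent continuous-time Markov chains that jump at rate $1$ according to $P$, with $X_0$ and $Y_0$ independent with law $\pi$, and let $Z$ be a random element of $\Omega$ with law $\pi$, independent of $X$ and $Y$ (so $Z$ does not move). Define \[M^{\rm good}=\inf\{t\ge0: X_t=Y_t\},\qquad M^{\rm bad}=\inf\{t\ge 0: X_t=Z\}\wedge\inf\{t\ge0: Y_t=Z\}.\] Then \[\mathbb P\big(M^{\rm good}<M^{\rm bad}\big)\ge \frac14.\]
   Context: An automorphism of $P$ (on state space $\Omega$) is a bijection $\phi:\Omega\to\Omega$ with $P(z,w)=P(\phi(z),\phi(w))$ for all $z,w\in\Omega$. $P$ is transitive if for all $x,y\in\Omega$ there is an automorphism $\phi$ of $P$ with $\phi(x)=y$. A continuous-time chain ''jumps at rate $\lambda$ according to $P$'' if it has generator $\lambda(P-I)$. *)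

(* Defs.v *)
From HB Require Import structures.
From mathcomp Require Import all_boot all_order all_algebra.
From mathcomp Require Import all_classical all_reals all_analysis.
Set Implicit Arguments. Unset Strict Implicit. Unset Printing Implicit Defensive.
Import Order.TTheory GRing.Theory Num.Theory numFieldNormedType.Exports.
Local Open Scope classical_set_scope.
Local Open Scope ring_scope.

Section Defs.
Variables (R : realType) (S : finType).
Implicit Types (P : S -> S -> R) (pi : S -> R).

Definition stochastic P :=
  (forall x y, 0 <= P x y) /\ (forall x, \sum_(y : S) P x y = 1).

Fixpoint mpow P (n : nat) (x y : S) : R :=
  if n is m.+1 then \sum_(z : S) P x z * mpow P m z y else (x == y)%:R.

Definition irreducible P := forall x y, exists n, 0 < mpow P n x y.

Definition stationary_dist P pi :=
  [/\ forall x, 0 <= pi x, \sum_(x : S) pi x = 1 &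
      forall y, \sum_(x : S) pi x * P x y = pi y].

Definition reversible P pi := forall x y, pi x * P x y = pi y * P y x.

Definition automorphism P (phi : S -> S) :=
  bijective phi /\ forall z w, P z w = P (phi z) (phi w).

Definition transitive_chain P :=
  forall x y, exists phi, automorphism P phi /\ phi x = y.

(* heat kernel exp(t (P - I)) of the chain jumping at rate 1 according to P *)
Definition heat P (t : R) (x y : S) : R :=
  expR (- t) * limn (series (fun k : nat => t ^+ k / (k`!)%:R * mpow P k x y)).

Definition cadlag (f : R -> S) :=
  (forall t, 0 <= t -> exists2 e : R, 0 < e &
     forall s, t <= s < t + e -> f s = f t) /\
  (forall t, 0 < t -> exists v : S, exists2 e : R, 0 < e &
     forall s, t - e < s < t -> f s = v).

(* first time two paths meet, in \bar R (+oo if never) *)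
Definition meet_time (f g : R -> S) : \bar R :=
  ereal_inf [set t%:E | t in [set t : R | 0 <= t /\ f t = g t]].

End Defs.

(* Joint finite-dimensional distributions: X, Y independent continuous-time
   chains with generator (P - I) started from pi, Z independent with law pi. *)
Definition XYZ_law (R : realType) (S : finType) (d : measure_display)
  (T : measurableType d) (mu : probability T R) (P : S -> S -> R) (pi : S -> R)
  (X Y : R -> T -> S) (Z : T -> S) :=
  forall (n : nat) (t : 'I_n.+1 -> R) (x y : 'I_n.+1 -> S) (z : S),
    t ord0 = 0 ->
    (forall i : 'I_n, t (widen_ord (leqnSn n) i) <= t (lift ord0 i)) ->
    mu ([set w | forall i, X (t i) w = x i /\ Y (t i) w = y i] `&`
        [set w | Z w = z]) =
    (pi z *
     (pi (x ord0) * \prod_(i < n)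
        heat P (t (lift ord0 i) - t (widen_ord (leqnSn n) i))
             (x (widen_ord (leqnSn n) i)) (x (lift ord0 i))) *
     (pi (y ord0) * \prod_(i < n)
        heat P (t (lift ord0 i) - t (widen_ord (leqnSn n) i))
             (y (widen_ord (leqnSn n) i)) (y (lift ord0 i))))%:E.

(* Main.v *)
(** Transitivity makes [P] symmetric with uniform stationary law on [n] states.
    Let [G] solve [(I - P) G = I - 1/n] with zero column sums. It is positive
    semidefinite with constant diagonal [g], so [s = g - G] takes values in
    [[0, 2g]], vanishes on the diagonal and has mean [g] (in fact [n * s x y] is the
    expected hitting time of [y] from [x]). The generator of [(X, Y, Z)] kills
      [F (x, y, z) = s x z + s y z - s x y]
    off the three diagonals, [F] vanishes where a walk sits on [z], and
    [F = 2 s x z <= 4 g] where [x = y]. Optional stopping therefore gives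
    [g = E F <= 4 g P(Mgood < Mbad)].

    Optional stopping is done on the skeleton of mesh [delta], whose kernel is
    [I + delta (P - I) + O(delta^2)]; subtracting [alpha * s x z] from [F], with
    [alpha = O(delta)], makes it a strict submartingale despite the error. By
    right-continuity of the paths, the event is the limsup of its skeleton
    versions as [delta] tends to 0. *)
Require Import Defs.
From HB Require Import structures.
From mathcomp Require Import all_boot all_order all_algebra.
From mathcomp Require Import all_classical all_reals all_analysis.
From mathcomp Require Import ring lra.
Import Order.TTheory GRing.Theory Num.Theory numFieldNormedType.Exports.
Local Open Scope classical_set_scope.
Local Open Scope ring_scope.
Set Implicit Arguments. Unset Strict Implicit. Unset Printing Implicit Defensive.

(** * The Green function of a transitive chain *)

Section Chain.
Variables (R : realType) (S : finType) (P : S -> S -> R).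
Hypotheses (stochP : stochastic P).
Let n : R := #|S|%:R.

Lemma mpow_ge0 k x y : 0 <= mpow P k x y.
Proof.
elim: k x => [|k IH] x /=; first by rewrite ler0n.
by apply: sumr_ge0 => z _; rewrite mulr_ge0 ?IH// stochP.1.
Qed.

Lemma mpow_row_sum k x : \sum_y mpow P k x y = 1.
Proof.
elim: k x => [|k IH] x /=.
  by rewrite (bigD1 x)//= eqxx big1 ?addr0// => y; rewrite eq_sym => /negbTE->.
rewrite exchange_big /= -(stochP.2 x); apply: eq_bigr => z _.
by rewrite -mulr_sumr IH mulr1.
Qed.

Lemma mpow_le1 k x y : mpow P k x y <= 1.
Proof.
rewrite -(mpow_row_sum k x) (bigD1 y)//= lerDl.
by apply: sumr_ge0 => z _; apply: mpow_ge0.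
Qed.

(** An automorphism taking [y] to [y'] carries one column onto the other, so all column sums agree;
    their average equals that of the row sums. *)
Lemma transitive_col_sum : transitive_chain P -> forall y, \sum_x P x y = 1.
Proof.
move=> trP.
have E y y' : \sum_x P x y = \sum_x P x y'.
  have [phi [[bij aut] <-]] := trP y y'.
  rewrite [RHS](reindex phi) /=; last exact: onW_bij.
  by apply: eq_bigr => x _; rewrite aut.
move=> y; have nz : n != 0.
  by rewrite pnatr_eq0 -lt0n; apply/card_gt0P; exists y.
apply: (mulfI nz); rewrite mulr1.
transitivity (\sum_(y' : S) \sum_x P x y').
  rewrite [RHS](eq_bigr (fun=> \sum_x P x y)) => [|y' _]; last exact: E.
  by rewrite sumr_const mulr_natl.
rewrite exchange_big /= (eq_bigr (fun=> 1)) => [|x _]; last exact: stochP.2.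
by rewrite sumr_const.
Qed.

Hypothesis colP : forall y, \sum_x P x y = 1.

(** When the square is expanded, row sums collapse one square term and column sums the other. *)
Lemma dirichlet_form f :
  \sum_x \sum_y P x y * (f x - f y) ^+ 2 =
  2 * (\sum_x f x ^+ 2 - \sum_x \sum_y f x * P x y * f y).
Proof.
have -> : \sum_x \sum_y P x y * (f x - f y) ^+ 2 =
   \sum_x \sum_y P x y * f x ^+ 2 + \sum_x \sum_y P x y * f y ^+ 2
   - 2 * \sum_x \sum_y f x * P x y * f y.
  rewrite mulr_sumr -big_split -sumrB; apply: eq_bigr => x _ /=.
  rewrite mulr_sumr -big_split -sumrB; apply: eq_bigr => y _ /=; ring.
have -> : \sum_x \sum_y P x y * f x ^+ 2 = \sum_x f x ^+ 2.
  by apply: eq_bigr => x _; rewrite -mulr_suml stochP.2 mul1r.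
have -> : \sum_x \sum_y P x y * f y ^+ 2 = \sum_x f x ^+ 2.
  by rewrite exchange_big; apply: eq_bigr => x _; rewrite -mulr_suml colP mul1r.
ring.
Qed.

Lemma dirichlet_form_ge0 f :
  \sum_x \sum_y f x * P x y * f y <= \sum_x f x ^+ 2.
Proof.
rewrite -subr_ge0 -(pmulr_rge0 _ (ltr0n R 2)) -dirichlet_form.
apply: sumr_ge0 => x _; apply: sumr_ge0 => y _.
by rewrite mulr_ge0 ?sqr_ge0// stochP.1.
Qed.

Hypothesis irrP : irreducible P.

(** Every term [P x y * (f x - f y) ^+ 2] must vanish, so [f] is constant along edges, and
    irreducibility joins any two states by edges. This shows that functions fixed by [P], acting on
    either side, are constant. *)
Lemma dirichlet_form_eq0 f :
  \sum_x \sum_y f x * P x y * f y = \sum_x f x ^+ 2 -> forall x y, f x = f y.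
Proof.
move=> E.
have ge0 x y : 0 <= P x y * (f x - f y) ^+ 2.
  by rewrite mulr_ge0 ?sqr_ge0// stochP.1.
have /eqP := dirichlet_form f; rewrite E subrr mulr0.
rewrite psumr_eq0 => [/allP D|x _]; last exact: sumr_ge0.
have edge x y : 0 < P x y -> f x = f y.
  have := D x (mem_index_enum x); rewrite /= psumr_eq0// => /allP/(_ y).
  rewrite mem_index_enum mulf_eq0 sqrf_eq0 subr_eq0 => /(_ isT)/orP[/eqP->|/eqP//].
  by rewrite ltxx.
move=> x y; have [k] := irrP x y; elim: k x => [|k IH] x /=.
  by case: eqP => [->//|_]; rewrite ltxx.
move=> pos; have := lt0r_neq0 pos.
rewrite psumr_neq0 => [/hasP[z _ /= zpos]|z _]; last first.
  by rewrite mulr_ge0 ?stochP.1 ?mpow_ge0.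
have Pz : 0 < P x z.
  by move: zpos; case: (ltgtP 0 (P x z)) (stochP.1 x z) => // <-; rewrite mul0r ltxx.
by rewrite (edge _ _ Pz) IH// -(pmulr_rgt0 _ Pz).
Qed.

(** Stationarity is the equality case of the Dirichlet inequality for [f = pi]. *)
Lemma stationary_uniform pi : stationary_dist P pi -> forall x, pi x = n^-1.
Proof.
case=> _ sum1 stat x.
have cst : forall y, pi y = pi x.
  move=> y; apply: dirichlet_form_eq0; rewrite exchange_big /=.
  by apply: eq_bigr => z _; rewrite -mulr_suml stat.
have /eqP := sum1; rewrite (eq_bigr _ (fun y _ => cst y)) sumr_const.
rewrite -mulr_natl => /eqP E; apply: (@mulfI _ n); last rewrite E ?divff//.
  all: by apply/eqP => n0; move: E; rewrite -/n n0 mul0r => /esym/eqP; rewrite oner_eq0.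
Qed.

(** The equation fixes each column of [G] only up to a constant, constants being the kernel of
    [I - P]; the zero column sums remove this freedom. *)
Lemma green_exists : exists G : S -> S -> R,
  (forall x y, G x y - \sum_z P x z * G z y = (x == y)%:R - n^-1) /\
  (forall y, \sum_x G x y = 0).
Proof.
have [S0|/card_gt0P[s0 _]] := posnP #|S|.
  by exists (fun _ _ => 0); split=> x; have := card0_eq S0 x.
have nz : n != 0 by rewrite pnatr_eq0 -lt0n; apply/card_gt0P; exists s0.
have sumc (c : R) : \sum_(x : S) c = n * c by rewrite sumr_const mulr_natl.
have sumd (f : S -> R) y : \sum_x f x * (x == y)%:R = f y.
  rewrite (bigD1 y)//= eqxx mulr1 big1 ?addr0// => x /negbTE->.
  by rewrite mulr0.
have sumd1 (y : S) : \sum_x (x == y)%:R = 1 :> R.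
  by rewrite -[RHS](sumd (fun=> 1) y); apply: eq_bigr => x _; rewrite mul1r.
(* [I - P] is singular, but adding the projection onto constants makes it
   invertible; subtracting that projection from the inverse gives [G]. *)
pose a x y : R := (x == y)%:R - P x y + n^-1.
pose A : 'M[R]_#|S| := \matrix_(i, j) a (enum_val i) (enum_val j).
have toS (f : S -> R) : \sum_(i < #|S|) f (enum_val i) = \sum_x f x.
  by rewrite [RHS](reindex (@enum_val S predT)) //=; exact/onW_bij/enum_val_bij.
have AE i y : A i (enum_rank y) = a (enum_val i) y by rewrite mxE enum_rankK.
(* A left null vector [f] has sum zero (add the equations over [y]), hence satisfies [f P = f],
   hence is constant, hence is zero. *)
have uA : A \in unitmx.
  rewrite -row_free_unit -kermx_eq0; apply/eqP/row_matrixP => i.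
  rewrite row0; set u := row i _; have uA0 : u *m A = 0.
    by rewrite /u -row_mul mulmx_ker row0.
  pose f x := u ord0 (enum_rank x).
  have fE y : f y - \sum_x f x * P x y + (\sum_x f x) / n = 0.
    have := congr1 (fun M : 'rV_#|S| => M ord0 (enum_rank y)) uA0.
    rewrite mxE [RHS]mxE => E; rewrite -[RHS]E.
    transitivity (\sum_x f x * a x y).
      rewrite -{1}(sumd f y) mulr_suml -sumrB -big_split.
      by apply: eq_bigr => x _; rewrite /a !mulrDr mulrN.
    rewrite -toS; apply: eq_bigr => j _.
    by rewrite /f enum_valK AE.
  have f0 : \sum_x f x = 0.
    have : \sum_y (f y - \sum_x f x * P x y + (\sum_x f x) / n) = 0.
      by rewrite big1.
    rewrite big_split sumrB exchange_big /= sumc mulrCA divff// mulr1.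
    rewrite [X in _ - X](eq_bigr f) => [|x _]; first by rewrite subrr add0r.
    by rewrite -mulr_sumr stochP.2 mulr1.
  have fcst x y : f x = f y.
    apply: dirichlet_form_eq0; rewrite exchange_big; apply: eq_bigr => z _.
    rewrite -mulr_suml expr2; congr (_ * _); apply/esym.
    by have /eqP := fE z; rewrite f0 mul0r addr0 subr_eq0 => /eqP.
  apply/rowP => j; rewrite [RHS]mxE.
  have -> : u ord0 j = f (enum_val j) by rewrite /f enum_valK.
  have := f0; rewrite (eq_bigr _ (fun x _ => fcst x (enum_val j))) sumc.
  by move/eqP; rewrite mulf_eq0 (negbTE nz) => /eqP.
pose B x y := invmx A (enum_rank x) (enum_rank y).
have BE x y : B x y - \sum_z P x z * B z y + (\sum_z B z y) / n = (x == y)%:R.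
  have := congr1 (fun M : 'M[R]_#|S| => M (enum_rank x) (enum_rank y)) (mulmxV uA).
  rewrite !mxE (inj_eq enum_rank_inj) => <-.
  transitivity (\sum_z a x z * B z y).
    rewrite -{1}(sumd (fun z => B z y) x) mulr_suml -sumrB -big_split.
    by apply: eq_bigr => z _ /=; rewrite /a (eq_sym x z); ring.
  rewrite -toS; apply: eq_bigr => j _.
  by rewrite /B enum_valK mxE enum_rankK.
(* Adding the equations over [x] cancels the [I - P] part. *)
have B1 y : \sum_x B x y = 1.
  have := sumd1 y; rewrite -(eq_bigr _ (fun x _ => BE x y)).
  rewrite big_split sumrB exchange_big /= sumc mulrCA divff// mulr1.
  rewrite [X in _ - X](eq_bigr (fun z => B z y)) => [|x _].
    by rewrite subrr add0r.
  by rewrite -mulr_suml colP mul1r.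
exists (fun x y => B x y - n^-1); split=> [x y|y]; last first.
  by rewrite sumrB B1 sumc divff// subrr.
have := BE x y; rewrite B1 mul1r => <-.
rewrite (eq_bigr (fun z => P x z * B z y - P x z * n^-1)) => [|z _].
  rewrite sumrB -[X in _ - (_ - X)]mulr_suml stochP.2; ring.
by rewrite mulrBr.
Qed.

End Chain.

Lemma hitting_kernel (R : realType) (S : finType) (P : S -> S -> R) :
  (1 < #|S|)%N -> stochastic P -> irreducible P -> transitive_chain P ->
  (forall x y, P x y = P y x) ->
  exists (s : S -> S -> R) (g : R),
  [/\ 0 < g, forall x, s x x = 0, forall x y, s x y = s y x,
      forall x y, 0 <= s x y <= 2 * g &
      (forall y, \sum_x s x y = #|S|%:R * g) /\
      forall x y, \sum_z P x z * s z y = s x y + (x == y)%:R - #|S|%:R^-1].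
Proof.
move=> S2 stochP irrP trP symP.
have colP := transitive_col_sum stochP trP.
have [G [GE G0]] := green_exists stochP colP irrP.
pose n : R := #|S|%:R.
have sumc (c : R) : \sum_(x : S) c = n * c by rewrite sumr_const mulr_natl.
have pairing f y : \sum_x f x * (G x y - \sum_z P x z * G z y) =
    f y - (\sum_x f x) / n.
  rewrite (eq_bigr (fun x => f x * (x == y)%:R - f x / n)) => [|x _].
    rewrite sumrB -mulr_suml (bigD1 y)//= eqxx mulr1 big1 ?addr0// => x.
    by move/negbTE->; rewrite mulr0.
  by rewrite GE mulrBr.
(* Both are values of the bilinear form of [I - P] at columns [a] and [b] of [G], and this form is
   symmetric because [P] is. *)
have symG a b : G a b = G b a.
  have <- : \sum_x G x a * (G x b - \sum_z P x z * G z b) = G b a.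
    by rewrite pairing G0 mul0r subr0.
  have <- : \sum_x G x b * (G x a - \sum_z P x z * G z a) = G a b.
    by rewrite pairing G0 mul0r subr0.
  rewrite (eq_bigr _ (fun x _ => mulrBr _ _ _)).
  rewrite [RHS](eq_bigr _ (fun x _ => mulrBr _ _ _)).
  rewrite !sumrB; congr (_ - _); first by apply: eq_bigr => x _; rewrite mulrC.
  rewrite (eq_bigr _ (fun x _ => mulr_sumr _ _ _ _)).
  rewrite [RHS](eq_bigr _ (fun x _ => mulr_sumr _ _ _ _)) exchange_big /=.
  by apply: eq_bigr => x _; apply: eq_bigr => z _; rewrite symP; ring.
(* [G] transported by [phi] solves the same equation, so the difference [D] is harmonic, hence
   constant, and its sum is zero. *)
have autG phi x y : automorphism P phi -> G (phi x) (phi y) = G x y.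
  move=> [bij aut]; pose D z := G (phi z) (phi y) - G z y.
  have Dh z : \sum_w P z w * D w = D z.
    rewrite (eq_bigr _ (fun w _ => mulrBr _ _ _)) sumrB.
    have -> : \sum_w P z w * G (phi w) (phi y) =
        \sum_w P (phi z) w * G w (phi y).
      rewrite [RHS](reindex phi) /=; last exact: onW_bij.
      by apply: eq_bigr => w _; rewrite aut.
    have := GE (phi z) (phi y); have := GE z y.
    rewrite (inj_eq (bij_inj bij)) /D; lra.
  have Dc z w : D z = D w.
    apply: (dirichlet_form_eq0 stochP colP irrP); apply: eq_bigr => v _.
    rewrite expr2 -{3}(Dh v) mulr_sumr.
    by apply: eq_bigr => u _; rewrite mulrA.
  have : \sum_z D z = 0.
    rewrite sumrB G0 subr0 -[RHS](G0 (phi y)) [RHS](reindex phi) //=.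
    by apply: onW_bij.
  rewrite (eq_bigr _ (fun z _ => Dc z x)) sumc => /eqP.
  rewrite mulf_eq0 pnatr_eq0 -leqn0 leqNgt (ltnW S2) /= subr_eq0.
  by move/eqP.
(* This is the quadratic form of [I - P] at column [a] plus [e] times column [b]; [e = 1] and
   [e = -1] later bound the entries of [G] by its diagonal. *)
have form_ge0 e a b : 0 <= G a a + e ^+ 2 * G b b + 2 * e * G a b.
  pose f x := G x a + e * G x b.
  have Pf : \sum_x f x * (f x - \sum_z P x z * f z) =
      G a a + e ^+ 2 * G b b + 2 * e * G a b.
    have fS : \sum_x f x = 0 by rewrite big_split -mulr_sumr !G0 /= mulr0 addr0.
    transitivity (\sum_x f x * (G x a - \sum_z P x z * G z a) +
        e * \sum_x f x * (G x b - \sum_z P x z * G z b)).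
      rewrite mulr_sumr -big_split; apply: eq_bigr => x _ /=.
      have -> : \sum_z P x z * f z =
          \sum_z P x z * G z a + e * \sum_z P x z * G z b.
        rewrite mulr_sumr -big_split; apply: eq_bigr => z _ /=; rewrite /f; ring.
      rewrite /f; ring.
    rewrite !pairing fS /f (symG b a); ring.
  rewrite -Pf (eq_bigr _ (fun x _ => mulrBr _ _ _)) sumrB subr_ge0.
  apply: le_trans (dirichlet_form_ge0 stochP colP f).
  rewrite le_eqVlt; apply/orP; left; apply/eqP/eq_bigr => x _.
  by rewrite mulr_sumr; apply: eq_bigr => z _; rewrite mulrA.
have [x0 _] : {x0 : S | true}.
  by apply: sigW; case/card_gt0P: (ltnW S2) => x0 _; exists x0.
pose g := G x0 x0.
have Gg x : G x x = g.
  by have [phi [aut <-]] := trP x0 x; rewrite autG.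
have Gb x y : - g <= G x y <= g.
  have := form_ge0 1 x y; have := form_ge0 (-1) x y; rewrite !Gg => h1 h2.
  by apply/andP; split; lra.
have g_gt0 : 0 < g.
  rewrite lt_neqAle; apply/andP; split; last first.
    by have /andP[h1 h2] := Gb x0 x0; lra.
  (* With [g = 0] the bounds kill [G], and its equation on the diagonal becomes [0 = 1 - 1/n],
     against [1 < #|S|]. *)
  apply/eqP => g0; have G00 x y : G x y = 0.
    by apply/eqP; rewrite eq_le; have := Gb x y; rewrite -g0 oppr0 andbC.
  have := GE x0 x0; rewrite G00 big1 => [|z _]; last by rewrite G00 mulr0.
  rewrite eqxx subr0 => /esym/eqP; rewrite subr_eq0 => /eqP /(congr1 (@GRing.inv R)).
  rewrite invrK invr1 => /esym/eqP; rewrite pnatr_eq1 => /eqP n1.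
  by rewrite n1 in S2.
exists (fun x y => g - G x y), g; split=> //.
- by move=> x; rewrite Gg subrr.
- by move=> x y; rewrite symG.
- by move=> x y; have /andP[h1 h2] := Gb x y; apply/andP; split; lra.
split=> [y|x y]; first by rewrite sumrB G0 subr0 sumc.
rewrite (eq_bigr _ (fun w _ => mulrBr _ _ _)) sumrB -mulr_suml stochP.2.
have := GE x y; rewrite /n; lra.
Qed.

(** * The heat kernel *)

Section Heat.
Variables (R : realType) (S : finType) (P : S -> S -> R).
Hypotheses (stochP : stochastic P).
Variable t : R.
Hypothesis t0 : 0 <= t.

Let u x y k : R := t ^+ k / (k`!)%:R * mpow P k x y.

Let u_ge0 x y k : 0 <= u x y k.
Proof. by rewrite !mulr_ge0 ?invr_ge0 ?exprn_ge0 ?(mpow_ge0 stochP) ?ler0n. Qed.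

(** The value of [limn] is meaningful only once convergence is known; the exponential series
    dominates. *)
Let cvg_u x y : cvgn (series (u x y)).
Proof.
apply: (@series_le_cvg R (u x y) (exp_coeff t)) => [k|k|k|].
- exact: u_ge0.
- by rewrite /exp_coeff mulr_ge0 ?invr_ge0 ?exprn_ge0 ?ler0n.
- rewrite /exp_coeff /u ler_piMr ?(mpow_le1 stochP)//.
  by rewrite mulr_ge0 ?invr_ge0 ?exprn_ge0 ?ler0n.
- exact: is_cvg_series_exp_coeff.
Qed.

(** The terms of orders 0 and 1 bound a series of nonnegative terms from below. *)
Lemma heat_ge x y : expR (- t) * ((x == y)%:R + t * P x y) <= heat P t x y.
Proof.
rewrite /heat ler_wpM2l ?expR_ge0//.
have mono : nondecreasing_seq (series (u x y)).
  by apply/nondecreasing_seqP => k; rewrite /series /= big_nat_recr//= lerDl.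
have := nondecreasing_cvgn_le mono (@cvg_u x y) 2; apply: le_trans.
rewrite /series /= !big_nat_recr//= big_geq// /u /= add0r expr0 expr1 fact0.
rewrite divr1 mul1r divr1 (bigD1 y)//= eqxx mulr1 big1 ?addr0// => z.
by move/negbTE->; rewrite mulr0.
Qed.

Lemma heat_ge0 x y : 0 <= heat P t x y.
Proof.
apply: le_trans (heat_ge x y).
by rewrite mulr_ge0 ?expR_ge0// addr_ge0 ?ler0n// mulr_ge0// stochP.1.
Qed.

Lemma heat_row_sum x : \sum_y heat P t x y = 1.
Proof.
rewrite -mulr_sumr.
have -> : \sum_y limn (series (u x y)) = expR t.
  apply/esym; rewrite /expR; apply: cvg_lim => //.
  have -> : series (exp_coeff t) = (fun k => \sum_y series (u x y) k).
    apply/funext => k; rewrite /series /= exchange_big /=.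
    by apply: eq_bigr => i _; rewrite -mulr_sumr (mpow_row_sum stochP) mulr1.
  by apply: cvg_big => [|y _]; [exact: add_continuous|exact: cvg_u].
by rewrite -expRD addNr expR0.
Qed.

End Heat.

(** * Optional stopping for the skeleton chain *)

Section OptionalStopping.
Variables (R : realType) (V : finType) (K : V -> V -> R) (w : V -> R).
Variable stop : pred V.

(* Mass at [v] after [j] steps of the chain started from [w], counting only the
   trajectories that avoid [stop] strictly before time [j]. *)
Fixpoint alive_mass (j : nat) (v : V) : R :=
  if j is i.+1 then \sum_(u | ~~ stop u) alive_mass i u * K u v else w v.

Hypotheses (K_ge0 : forall u v, 0 <= K u v) (K_row_sum : forall u, \sum_v K u v = 1).
Hypothesis w_ge0 : forall v, 0 <= w v.

Lemma alive_mass_ge0 j v : 0 <= alive_mass j v.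
Proof.
elim: j v => [|j IH] v //=.
by apply: sumr_ge0 => u _; rewrite mulr_ge0.
Qed.

(** Finite-horizon version: [U] gains at least [eta] on average per live step, so [N] steps earn
    [N * eta >= B] per unit of surviving mass. This pays for the value of [U] on the mass left at
    time [N], and no almost sure absorption has to be proved. *)
Lemma optional_stopping (U : V -> R) (good : pred V) (c eta B : R) (N : nat) :
  0 <= c -> 0 <= eta -> B <= N%:R * eta ->
  (forall v, U v <= B) ->
  (forall v, stop v -> U v <= c * (good v)%:R) ->
  (forall v, ~~ stop v -> U v + eta <= \sum_v' K v v' * U v') ->
  \sum_v w v * U v <= c * \sum_(j < N) \sum_(v | good v) alive_mass j v.
Proof.
move=> c0 eta0 BN UB Ustop Ualive.
pose tot j := \sum_v alive_mass j v.
(* Reward collected before time [j], plus the integral of [U] over the mass present at time [j]. *)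
pose Phi j := c * (\sum_(i < j) \sum_(v | good v) alive_mass i v) +
  \sum_v alive_mass j v * U v.
have totS j : tot j.+1 = \sum_(u | ~~ stop u) alive_mass j u.
  rewrite /tot /= exchange_big /=; apply: eq_bigr => u _.
  by rewrite -mulr_sumr K_row_sum mulr1.
have tot_le j : tot j.+1 <= tot j.
  rewrite totS /tot [leRHS](bigID stop) /= lerDr.
  by apply: sumr_ge0 => v _; exact: alive_mass_ge0.
(* Mass on [stop] is exchanged for reward by [Ustop]; the rest moves on and gains [eta] by
   [Ualive]. *)
have step j : Phi j + eta * tot j.+1 <= Phi j.+1.
  rewrite /Phi big_ord_recr /= mulrDr -!addrA lerD2l.
  rewrite (bigID stop) /= -addrA; apply: lerD.
    rewrite mulr_sumr [leRHS]big_mkcond [leLHS]big_mkcond /=.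
    apply: ler_sum => v _; have m0 := alive_mass_ge0 j v.
    case: ifP => [/Ustop Uv|_]; last by case: ifP => // _; rewrite mulr_ge0.
    have := ler_wpM2l m0 Uv.
    by case: (good v); rewrite /= ?mulr0 ?mulr1// (mulrC c).
  under [leRHS]eq_bigr do rewrite mulr_suml.
  rewrite exchange_big /= totS mulr_sumr -big_split /=.
  apply: ler_sum => u us.
  have := ler_wpM2l (alive_mass_ge0 j u) (Ualive u us).
  rewrite mulrDr mulrC mulr_sumr [alive_mass j u * eta]mulrC.
  rewrite [U u * _]mulrC => /le_trans; apply.
  by apply: ler_sum => v _; rewrite mulrA.
have Phi_ge j : Phi 0 + j%:R * eta * tot j <= Phi j.
  elim: j => [|j IH]; first by rewrite !mul0r addr0.
  apply: le_trans (step j); apply: le_trans (lerD IH (lexx _)).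
  have := ler_wpM2l (mulr_ge0 (ler0n R j) eta0) (tot_le j).
  rewrite -natr1; lra.
have tot0 : 0 <= tot N by apply: sumr_ge0 => v _; exact: alive_mass_ge0.
have PhiN : Phi N <= c * (\sum_(i < N) \sum_(v | good v) alive_mass i v) +
    N%:R * eta * tot N.
  rewrite lerD2l; apply: le_trans (ler_wpM2r tot0 BN).
  rewrite mulr_sumr; apply: ler_sum => v _.
  by rewrite mulrC ler_wpM2r// alive_mass_ge0.
have := le_trans (Phi_ge N) PhiN; rewrite lerD2r; apply: le_trans.
by rewrite /Phi big_ord0 mulr0 add0r.
Qed.

End OptionalStopping.

(** * Drift estimate for two independent walks observed at mesh [delta] *)

Section Skeleton.
Variables (R : realType) (S : finType) (P Q : S -> S -> R) (delta : R).

Definition pair_kernel (p q : S * S) : R := Q p.1 q.1 * Q p.2 q.2.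
(** Excluding [z] makes a simultaneous arrival of both walks at [z] a failure, as the strict
    inequality between the two times requires. *)
Definition collided (z : S) (p : S * S) := (p.1 == p.2) && (p.1 != z).
Definition stopped (z : S) (p : S * S) :=
  [|| p.1 == z, p.2 == z | p.1 == p.2].

Hypotheses (P_ge0 : forall x y, 0 <= P x y) (Q_ge0 : forall x y, 0 <= Q x y).
Hypothesis P_row_sum : forall x, \sum_y P x y = 1.
Hypothesis Q_row_sum : forall x, \sum_y Q x y = 1.
Hypotheses (delta_gt0 : 0 < delta) (delta_le : delta <= 1 / 4).
Hypothesis Q_ge :
  forall x y, (1 - delta) * ((x == y)%:R + delta * P x y) <= Q x y.

Lemma pair_kernel_row_sum p : \sum_q pair_kernel p q = 1.
Proof.
rewrite -(pair_big xpredT xpredT (fun x y => Q p.1 x * Q p.2 y)) /=.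
rewrite (eq_bigr (fun x => Q p.1 x)) => [|x _]; first exact: Q_row_sum.
by rewrite -mulr_sumr Q_row_sum mulr1.
Qed.

(** Multiply the lower bounds of the two coordinates and keep the moves of at most one walk. Since
    the kernel is only bounded below, [f] has to be nonnegative. *)
Lemma pair_kernel_ge (f : S -> S -> R) x y : (forall x y, 0 <= f x y) ->
  (1 - 2 * delta) * (f x y + delta * (\sum_x' P x x' * f x' y +
                                      \sum_y' P y y' * f x y')) <=
  \sum_q pair_kernel (x, y) q * f q.1 q.2.
Proof.
move=> f_ge0.
rewrite -(pair_big xpredT xpredT (fun x' y' => Q x x' * Q y y' * f x' y')) /=.
have sumd (a : S) (h : S -> R) : \sum_b (a == b)%:R * h b = h a.
  rewrite (bigD1 a)//= eqxx mul1r big1 ?addr0// => b.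
  by rewrite eq_sym => /negbTE->; rewrite mul0r.
have -> : f x y + delta * (\sum_x' P x x' * f x' y + \sum_y' P y y' * f x y') =
    \sum_x' \sum_y' ((x == x')%:R * (y == y')%:R +
      delta * (P x x' * (y == y')%:R + (x == x')%:R * P y y')) * f x' y'.
  transitivity (\sum_x' (x == x')%:R * (\sum_y' (y == y')%:R * f x' y') +
     delta * (\sum_x' P x x' * (\sum_y' (y == y')%:R * f x' y') +
              \sum_x' (x == x')%:R * (\sum_y' P y y' * f x' y'))).
    rewrite !sumd; congr (_ + _ * (_ + _)).
    by apply: eq_bigr => x' _; rewrite sumd.
  rewrite -big_split mulr_sumr -big_split /=; apply: eq_bigr => x' _.
  rewrite !mulr_sumr -big_split mulr_sumr -big_split /=; apply: eq_bigr => y' _.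
  ring.
rewrite mulr_sumr; apply: ler_sum => x' _; rewrite mulr_sumr.
apply: ler_sum => y' _; rewrite mulrA; apply: ler_wpM2r => //.
have d1 : 0 <= 1 - delta by move: delta_le; lra.
have l1 a b : 0 <= (a == b)%:R + delta * P a b.
  by rewrite addr_ge0 ?ler0n ?mulr_ge0// ltW.
apply: (le_trans _ (ler_pM (mulr_ge0 d1 (l1 x x')) (mulr_ge0 d1 (l1 y y'))
  (Q_ge x x') (Q_ge y y'))).
have := P_ge0 x x'; have := P_ge0 y y'; move: (P x x') (P y y') => p p'.
have : 0 <= (x == x')%:R :> R by []. have : 0 <= (y == y')%:R :> R by [].
move: ((x == x')%:R : R) ((y == y')%:R : R) => a b b0 a0 p'0 p0.
have dp := ltW delta_gt0.
have e1 : 0 <= a * b + delta * (p * b + a * p').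
  by rewrite addr_ge0 ?mulr_ge0// addr_ge0 ?mulr_ge0.
(* The two discarded remainders: [e2] comes from [(1 - delta) ^+ 2 = 1 - 2 * delta + delta ^+ 2],
   and [e3] from both walks moving at once. *)
have e2 := mulr_ge0 (sqr_ge0 delta) e1.
have e3 : 0 <= (1 - delta) ^+ 2 * (delta ^+ 2 * (p * p')).
  by rewrite !mulr_ge0 ?sqr_ge0.
rewrite -subr_ge0; apply: le_trans (addr_ge0 e2 e3) _.
by rewrite le_eqVlt; apply/orP; left; apply/eqP; ring.
Qed.

Variables (s : S -> S -> R) (g : R).
Let n : R := #|S|%:R.
Hypotheses (S_gt0 : (0 < #|S|)%N) (g_gt0 : 0 < g) (s_diag : forall x, s x x = 0).
Hypotheses (s_sym : forall x y, s x y = s y x).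
Hypotheses (s_bound : forall x y, 0 <= s x y <= 2 * g).
Hypothesis s_sum : forall y, \sum_x s x y = n * g.
Hypothesis s_poisson :
  forall x y, \sum_z P x z * s z y = s x y + (x == y)%:R - n^-1.

(** Optional stopping for [u] with [c = B = 4 * g] and [eta = delta ^+ 2]; dividing the initial mean
    [g * (1 - alpha)] by [4 * g] gives the bound. *)
Lemma skeleton_collision (z : S) (N : nat) :
  let alpha := 2 * n * (32 * g + 1) * delta in
  alpha <= 1 -> 4 * g <= N%:R * delta ^+ 2 ->
  (1 - alpha) / 4 <= \sum_(j < N) \sum_(p | collided z p)
     alive_mass pair_kernel (fun=> n^-1 * n^-1) (stopped z) j p.
Proof.
move=> alpha al1 Nbig.
have n_gt0 : 0 < n by rewrite ltr0n.
have nn0 : n != 0 by rewrite gt_eqF.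
have al0 : 0 <= alpha.
  have g32 : 0 <= 32 * g + 1 by move: g_gt0; lra.
  by rewrite !mulr_ge0// ltW.
(* Off the diagonals the generator sends [- alpha * s x z] to
   [alpha / n = 2 * (32 * g + 1) * delta]. Over one step this is a gain of order [delta ^+ 2], the
   same order as the kernel error. *)
pose u x y := s x z + s y z - s x y - alpha * s x z.
have as_bound x : 0 <= alpha * s x z <= 2 * g.
  have /andP[h1 h2] := s_bound x z; rewrite mulr_ge0//=.
  by apply: le_trans (ler_wpM2r h1 al1) _; rewrite mul1r.
have ub x y : - (4 * g) <= u x y <= 4 * g.
  have := s_bound x z; have := s_bound y z; have := s_bound x y.
  have := as_bound x; rewrite /u.
  by move=> /andP[? ?] /andP[? ?] /andP[? ?] /andP[? ?]; apply/andP; split; lra.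
have Pc x (c : R) : \sum_x' P x x' * c = c by rewrite -mulr_suml P_row_sum mul1r.
(* The shift by [4 * g] makes [u] nonnegative, as [pair_kernel_ge] demands. *)
have P1 x y : \sum_x' P x x' * (u x' y + 4 * g) =
    u x y + 4 * g + (1 - alpha) * ((x == z)%:R - n^-1) - ((x == y)%:R - n^-1).
  transitivity ((1 - alpha) * \sum_x' P x x' * s x' z
     - \sum_x' P x x' * s x' y + \sum_x' P x x' * (s y z + 4 * g)).
    rewrite mulr_sumr -sumrB -big_split; apply: eq_bigr => x' _.
    by rewrite /u /=; ring.
  rewrite !s_poisson Pc /u; ring.
have P2 x y : \sum_y' P y y' * (u x y' + 4 * g) =
    u x y + 4 * g + ((y == z)%:R - n^-1) - ((x == y)%:R - n^-1).
  transitivity (\sum_y' P y y' * s y' z - \sum_y' P y y' * s y' x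
     + \sum_y' P y y' * (s x z - alpha * s x z + 4 * g)).
    rewrite -sumrB -big_split; apply: eq_bigr => y' _.
    by rewrite /u /= (s_sym x y'); ring.
  rewrite !s_poisson Pc /u (s_sym x y) (eq_sym x y); ring.
have g4 : 0 <= 4 * g by rewrite mulr_ge0// ltW.
(* Under the uniform law each of the three [s] terms has mean [g], and the correction has mean
   [alpha * g]. *)
have E : \sum_(v : S * S) n^-1 * n^-1 * u v.1 v.2 = g * (1 - alpha).
  rewrite -mulr_sumr -(pair_big xpredT xpredT u) /=.
  have sumc (c : R) : \sum_(x : S) c = n * c by rewrite sumr_const mulr_natl.
  have sum_s' x : \sum_y s x y = n * g.
    by rewrite -(s_sum x); apply: eq_bigr => y _; rewrite s_sym.
  have -> : \sum_x \sum_y u x y = n * (n * g) * (1 - alpha).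
    transitivity (\sum_x (n * (s x z - alpha * s x z) + n * g - n * g)).
      apply: eq_bigr => x _.
      transitivity (\sum_y (s x z - alpha * s x z + s y z - s x y)).
        by apply: eq_bigr => y _; rewrite /u; ring.
      by rewrite sumrB big_split /= sumc sum_s' s_sum.
    under eq_bigr do rewrite addrK.
    by rewrite -mulr_sumr sumrB -mulr_sumr s_sum; ring.
  by field.
have H : g * (1 - alpha) <= 4 * g * \sum_(j < N) \sum_(p | collided z p)
     alive_mass pair_kernel (fun=> n^-1 * n^-1) (stopped z) j p.
  rewrite -E; apply: (@optional_stopping _ _ pair_kernel _ (stopped z) _ _ _
    (fun p => u p.1 p.2) (collided z) (4 * g) (delta ^+ 2) (4 * g)) => //.
  - by move=> p q; rewrite /pair_kernel mulr_ge0.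
  - exact: pair_kernel_row_sum.
  - by move=> _; rewrite mulr_ge0// invr_ge0 ltW.
  - exact: sqr_ge0.
  - by move=> p; have /andP[] := ub p.1 p.2.
  (* At a meeting away from [z], [u <= 2 * s x z <= 4 * g]; with a walk on [z], two terms cancel and
     [u <= 0]. *)
  - move=> [x y] /=; rewrite /stopped /collided /=.
    have := as_bound x => /andP[asx _].
    case: (eqVneq x y) => [<-|xy].
      case: (eqVneq x z) => [->|xz _] /=.
        by rewrite /u s_diag mulr0n !mulr0 !subr0 addr0.
      rewrite /u s_diag mulr1; have /andP[_] := s_bound x z; lra.
    rewrite /= orbF mulr0 /u => /orP[/eqP->|/eqP->]; rewrite s_diag.
      by rewrite (s_sym y z); lra.
    lra.
  - move=> [x y]; rewrite /stopped !negb_or /= => /and3P[xz yz xy].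
    have U0 x' y' : 0 <= u x' y' + 4 * g by have /andP[] := ub x' y'; lra.
    have := @pair_kernel_ge (fun x y => u x y + 4 * g) x y U0.
    rewrite P1 P2 (negbTE xz) (negbTE yz) (negbTE xy) !mulr0n.
    have -> : \sum_q pair_kernel (x, y) q * (u q.1 q.2 + 4 * g) =
        \sum_q pair_kernel (x, y) q * u q.1 q.2 + 4 * g.
      rewrite (eq_bigr _ (fun q _ => mulrDr _ _ _)) big_split /= -mulr_suml.
      by rewrite pair_kernel_row_sum mul1r.
    move=> h; rewrite -(lerD2r (4 * g)).
    apply: le_trans h.
    have /andP[_ u4] := ub x y.
    have -> : alpha = 2 * n * (32 * g + 1) * delta by [].
    have -> : (1 - 2 * delta) * (u x y + 4 * g + delta *
      (u x y + 4 * g + (1 - 2 * n * (32 * g + 1) * delta) *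
         (0 - n^-1) - (0 - n^-1) +
       (u x y + 4 * g + (0 - n^-1) - (0 - n^-1)))) =
      u x y + 4 * g - 4 * delta ^+ 2 * (u x y + 4 * g) +
      (1 - 2 * delta) * (2 * delta ^+ 2 * (32 * g + 1)).
      by field.
    have d2 := sqr_ge0 delta.
    (* The error costs at most [32 * g * delta ^+ 2], while the correction yields at least
       [(32 * g + 1) * delta ^+ 2] because [1 - 2 * delta >= 1 / 2]; the surplus is [eta]. *)
    have h1 : 4 * delta ^+ 2 * (u x y + 4 * g) <= 4 * delta ^+ 2 * (8 * g).
      by apply: ler_wpM2l; [rewrite mulr_ge0|lra].
    have h2 : (1 / 2) * (2 * delta ^+ 2 * (32 * g + 1)) <=
        (1 - 2 * delta) * (2 * delta ^+ 2 * (32 * g + 1)).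
      apply: ler_wpM2r; last by move: delta_le; lra.
      have g32 : 0 <= 32 * g + 1 by move: g_gt0; lra.
      exact: mulr_ge0 (mulr_ge0 (ler0n R 2) d2) g32.
    move: (4 * _ * _) ((1 - _) * _) h1 h2 => a b h1 h2. lra.
rewrite -(ler_pM2l (_ : 0 < 4 * g)); last by rewrite mulr_gt0.
by apply: le_trans H; rewrite le_eqVlt; apply/orP; left; apply/eqP; field.
Qed.

End Skeleton.

(** * Law of the skeleton *)

Lemma measure_bigcup_finType (R : realType) (d : measure_display)
  (T : measurableType d) (mu : {measure set T -> \bar R}) (I : finType)
  (a : pred I) (F : I -> set T) :
  (forall i, measurable (F i)) ->
  (forall i j w, a i -> a j -> F i w -> F j w -> i = j) ->
  mu (\bigcup_(i in [set i | a i]) F i) = (\sum_(i | a i) mu (F i))%E.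
Proof.
move=> mF disj; have E : [set i | a i] = [set` enum a].
  by apply/seteqP; split=> i /=; rewrite mem_enum.
rewrite measure_fin_bigcup//.
- by rewrite E -fsbig_seq ?enum_uniq// big_enum.
- exact: finite_finset.
- by move=> i j ai aj [w [Fi Fj]]; apply: disj Fi Fj.
Qed.

Section Markov.
Variables (R : realType) (S : finType) (P : S -> S -> R) (pi : S -> R).
Variables (d : measure_display) (T : measurableType d) (mu : probability T R).
Variables (X Y : R -> T -> S) (Z : T -> S).
Hypothesis mX : forall t x, measurable [set w | X t w = x].
Hypothesis mY : forall t x, measurable [set w | Y t w = x].
Hypothesis mZ : forall x, measurable [set w | Z w = x].
Hypothesis law : XYZ_law mu P pi X Y Z.
Variable delta : R.
Hypothesis delta_ge0 : 0 <= delta.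

Definition skeleton (j : nat) (w : T) : S * S :=
  (X (j%:R * delta) w, Y (j%:R * delta) w).

Definition alive_cylinder (j m : nat) (f : nat -> S * S) (z : S) : set T :=
  [set w | [/\ forall i, (i < j)%N -> ~~ stopped z (skeleton i w),
    forall i, (i <= m)%N -> skeleton (j + i) w = f i & Z w = z]].

Lemma measurable_skeleton (a : pred (S * S)) j :
  measurable [set w | a (skeleton j w)].
Proof.
have -> : [set w | a (skeleton j w)] = \bigcup_(p in [set p | a p])
    ([set w | X (j%:R * delta) w = p.1] `&` [set w | Y (j%:R * delta) w = p.2]).
  apply/seteqP; split => [w /= aw|w [p /= ap [e1 e2]]].
    by exists (skeleton j w).
  by rewrite /skeleton e1 e2 -surjective_pairing.
apply: fin_bigcup_measurable; first exact: finite_finset.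
by move=> p _; apply: measurableI.
Qed.

Lemma measurable_forall_ltn (A : nat -> set T) (j : nat) :
  (forall i, measurable (A i)) ->
  measurable [set w | forall i, (i < j)%N -> A i w].
Proof.
move=> mA; have -> : [set w | forall i, (i < j)%N -> A i w] =
  \bigcap_(i in [set i | (i < j)%N]) A i by [].
exact: bigcap_measurableType.
Qed.

Lemma measurable_alive_cylinder j m f z : measurable (alive_cylinder j m f z).
Proof.
have -> : alive_cylinder j m f z =
  [set w | forall i, (i < j)%N -> ~~ stopped z (skeleton i w)] `&`
  ([set w | forall i, (i < m.+1)%N -> skeleton (j + i) w == f i] `&`
   [set w | Z w = z]).
  apply/seteqP; split=> w /=.
    by move=> [h1 h2 h3]; split=> //; split=> // i /h2/eqP.
  by move=> [h1 [h2 h3]]; split=> // i /h2/eqP.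
apply: measurableI.
  apply: (@measurable_forall_ltn (fun i => [set w | ~~ stopped z (skeleton i w)])).
  by move=> i; apply: (@measurable_skeleton (fun p => ~~ stopped z p)).
apply: measurableI => //.
apply: (@measurable_forall_ltn (fun i => [set w | skeleton (j + i) w == f i])).
by move=> i; apply: (@measurable_skeleton (fun p => p == f i)).
Qed.

Let K := pair_kernel (heat P delta).
Let mass z := alive_mass K (fun p => pi p.1 * pi p.2) (stopped z).

(* The [m] prescribed future states make the induction on [j] close: one step of
   the killed past is traded for one more future state. *)
Lemma alive_cylinder_law j m f z :
  mu (alive_cylinder j m f z) =
  (pi z * (mass z j (f 0) * \prod_(i < m) K (f i) (f i.+1)))%:E.
Proof.
elim: j m f => [|j IH] m f.
  (* With [j = 0] no survival condition remains, and the event is a cylinder of the given law at the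
     times [i * delta]. *)
  have -> : alive_cylinder 0 m f z =
    [set w | forall i : 'I_m.+1, X (i%:R * delta) w = (f i).1 /\
                                 Y (i%:R * delta) w = (f i).2] `&`
    [set w | Z w = z].
    apply/seteqP; split=> w /=.
      move=> [_ h2 h3]; split=> // i.
      by have := h2 i; rewrite -ltnS ltn_ord => /(_ isT) <-.
    move=> [h2 h3]; split=> // i im.
    have /= [e1 e2] := h2 (Ordinal (im : (i < m.+1)%N)).
    by rewrite add0n /skeleton e1 e2 -surjective_pairing.
  rewrite (@law m (fun i => i%:R * delta) (fun i => (f i).1) (fun i => (f i).2)) //=.
  - congr (_%:E); rewrite -mulrA; congr (_ * _).
    rewrite mulrACA -big_split /=; congr (_ * _); apply: eq_bigr => i _.
    rewrite /K /pair_kernel /bump leq0n add1n -natr1 mulrDl mul1r.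
    by rewrite addrAC subrr add0r.
  - by rewrite mul0r.
  - by move=> i; rewrite ler_wpM2r// ler_nat /bump leq0n add1n.
pose cons v i := if i is k.+1 then f k else v : S * S.
have -> : alive_cylinder j.+1 m f z =
    \bigcup_(v in [set v | ~~ stopped z v]) alive_cylinder j m.+1 (cons v) z.
  apply/seteqP; split=> w /=.
    move=> [h1 h2 h3]; exists (skeleton j w); first exact: h1.
    split=> // [i ij|[|i] im /=]; first by apply: h1; apply: ltnW.
      by rewrite addn0.
    by rewrite addnS -addSn h2.
  move=> [v /= sv [h1 h2 h3]]; split=> // i.
    rewrite ltnS leq_eqVlt => /orP[/eqP->|/h1//].
    by have := h2 0 isT; rewrite addn0 => ->.
  by move=> im; rewrite addSn -addnS (h2 i.+1).
rewrite (@measure_bigcup_finType _ _ _ mu _ (fun v => ~~ stopped z v)) /=.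
- rewrite (eq_bigr _ (fun v _ => IH m.+1 (cons v))) sumEFin; congr (_%:E).
  rewrite -mulr_sumr; congr (_ * _).
  rewrite mulr_suml; apply: eq_bigr => v _.
  by rewrite big_ord_recl /= mulrA.
- by move=> v; exact: measurable_alive_cylinder.
- by move=> v v' w _ _ [_ /(_ 0 isT) e _] [_ /(_ 0 isT) e' _]; rewrite -[v]e -[v']e'.
Qed.

Definition skeleton_good (N : nat) : set T :=
  [set w | exists j, [/\ (j < N)%N, collided (Z w) (skeleton j w) &
     forall i, (i < j)%N -> ~~ stopped (Z w) (skeleton i w)]].

Let F N (q : S * ('I_N * (S * S))) :=
  alive_cylinder q.2.1 0 (fun=> q.2.2) q.1.

Let skeleton_goodE N : skeleton_good N =
  \bigcup_(q in [set q | collided q.1 q.2.2]) @F N q.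
Proof.
apply/seteqP; split=> w /=.
  move=> [j [jN col h]]; exists (Z w, (Ordinal jN, skeleton j w)) => //=.
  by split=> // i; rewrite leqn0 => /eqP->; rewrite addn0.
move=> [[z [j p]] /= col [h1 /(_ 0 isT) h2 h3]]; exists j; rewrite h3.
by split=> //; rewrite -(addn0 j) h2.
Qed.

Lemma measurable_skeleton_good N : measurable (skeleton_good N).
Proof.
rewrite skeleton_goodE; apply: fin_bigcup_measurable.
  exact: finite_finset.
by move=> q _; apply: measurable_alive_cylinder.
Qed.

Lemma skeleton_good_law N :
  mu (skeleton_good N) =
  (\sum_z pi z * \sum_(j < N) \sum_(p | collided z p) mass z j p)%:E.
Proof.
(* A collision stops the pair, so distinct collision times give disjoint events and the measures add
   up. *)
have sub i i' p p' z w : (i < i')%N -> collided z p ->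
    alive_cylinder i 0 (fun=> p) z w -> alive_cylinder i' 0 (fun=> p') z w ->
    False.
  move=> ii' /andP[/eqP c _] [_ /(_ 0 isT) e _] [/(_ i ii') + _ _].
  by rewrite -(addn0 i) e /stopped c eqxx !orbT.
rewrite skeleton_goodE.
rewrite (@measure_bigcup_finType _ _ _ mu _ (fun q => collided q.1 q.2.2)).
- rewrite (eq_bigr (fun q : S * ('I_N * (S * S)) =>
    (pi q.1 * mass q.1 q.2.1 q.2.2)%:E)); last first.
    move=> q _; have := alive_cylinder_law q.2.1 0 (fun=> q.2.2) q.1.
    by rewrite big_ord0 mulr1.
  rewrite sumEFin; congr (_%:E).
  rewrite -(pair_big_dep xpredT (fun z jp => collided z jp.2)
    (fun z (jp : 'I_N * (S * S)) => pi z * mass z jp.1 jp.2)) /=.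
  apply: eq_bigr => z _; rewrite -mulr_sumr; congr (_ * _).
  by rewrite -(pair_big_dep xpredT (fun _ p => collided z p)
    (fun (j : 'I_N) p => mass z j p)).
- by move=> q; apply: measurable_alive_cylinder.
- move=> [z [j p]] [z' [j' p']] w /= c c' F1 F2.
  have zz : z = z' by have [_ _ /= e] := F1; have [_ _ /= e'] := F2; rewrite -e -e'.
  rewrite -zz in c' F2 *; rewrite /F /= in F1 F2.
  have jj : j = j'.
    apply/val_inj; case: (ltngtP j j') => //= jj'.
      by have := sub _ _ _ _ _ _ jj' c F1 F2.
    by have := sub _ _ _ _ _ _ jj' c' F2 F1.
  rewrite -jj in F2 *; have [_ /(_ 0 isT) e _] := F1.
  by have [_ /(_ 0 isT) e' _] := F2; rewrite -[p]e -[p']e'.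
Qed.

End Markov.

(** * From skeleton events to path events *)

Section Paths.
Variables (R : realType) (S : finType).
Implicit Types (f g : R -> S) (z : S).

Let pair_right_constant f g t : cadlag f -> cadlag g -> 0 <= t ->
  exists2 e : R, 0 < e & forall s, t <= s < t + e -> f s = f t /\ g s = g t.
Proof.
move=> [cf _] [cg _] t0; have [e e0 fe] := cf t t0; have [e' e'0 ge'] := cg t t0.
exists (Num.min e e'); first by rewrite lt_min e0.
move=> s /andP[ts]; rewrite -ltrBlDl lt_min => /andP[se se'].
by rewrite fe ?ge'// ts -ltrBlDl.
Qed.

(** Replaces the comparison of infima by a witness time. Conversely, right-continuity prolongs the
    avoidance of [z] slightly beyond [t], which makes the inequality strict. *)
Lemma collide_before_trap f g z : cadlag f -> cadlag g ->
  (meet_time f g < Order.min (meet_time f (fun=> z)) (meet_time g (fun=> z)))%E <->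
  exists t, [/\ 0 <= t, f t = g t &
    forall s, 0 <= s <= t -> f s != z /\ g s != z].
Proof.
move=> cf cg; split.
  move=> /ereal_inf_ltP[_ [t [t0 fgt] <-]]; rewrite lt_min => /andP[tf tg].
  exists t; split=> // s /andP[s0 st]; split; apply/eqP => E.
    have : (meet_time f (fun=> z) <= s%:E)%E by apply: ereal_inf_lbound; exists s.
    by move=> /(lt_le_trans tf); rewrite lte_fin ltNge st.
  have : (meet_time g (fun=> z) <= s%:E)%E by apply: ereal_inf_lbound; exists s.
  by move=> /(lt_le_trans tg); rewrite lte_fin ltNge st.
move=> [t [t0 fgt ok]].
have [e e0 cst] := pair_right_constant cf cg t0.
have lower h : (forall s, 0 <= s < t + e -> h s != z) ->
    (t%:E < meet_time h (fun=> z))%E.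
  move=> hz; apply: (@lt_le_trans _ _ (t + e)%:E); first by rewrite lte_fin ltrDl.
  apply: le_ereal_inf_tmp => _ [s [s0 hs] <-]; rewrite lee_fin leNgt.
  by apply/negP => ste; have := hz s; rewrite s0 ste hs eqxx => /(_ isT).
have away s : 0 <= s < t + e -> f s != z /\ g s != z.
  move=> /andP[s0 ste]; have [st|ts] := leP s t; first by apply: ok; rewrite s0.
  have ts' : t <= s < t + e by rewrite (ltW ts).
  by have [-> ->] := cst s ts'; apply: ok; rewrite t0 lexx.
apply: (@le_lt_trans _ _ t%:E); first by apply: ereal_inf_lbound; exists t.
by rewrite lt_min !lower// => s /away[].
Qed.

(** Both paths are constant on some [[t, t + e)], so a mesh below [e] has a grid point there at
    which they agree. The first grid meeting is no later, and [z] is avoided throughout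
    [[0, t + e)]. *)
Lemma skeleton_eventually_collides f g z t (delta : nat -> R) (N : nat -> nat) :
  cadlag f -> cadlag g -> 0 <= t -> f t = g t ->
  (forall s, 0 <= s <= t -> f s != z /\ g s != z) ->
  (forall k, 0 < delta k) ->
  (forall e, 0 < e -> exists k0, forall k, (k0 <= k)%N -> delta k < e) ->
  (forall t, exists k0, forall k, (k0 <= k)%N -> t < (N k)%:R * delta k) ->
  exists k0, forall k, (k0 <= k)%N -> exists j,
    [/\ (j < N k)%N, f (j%:R * delta k) = g (j%:R * delta k),
        f (j%:R * delta k) != z &
        forall i, (i < j)%N -> [/\ f (i%:R * delta k) != z,
          g (i%:R * delta k) != z & f (i%:R * delta k) != g (i%:R * delta k)]].
Proof.
move=> cf cg t0 fgt ok delta_gt0 delta_small N_large.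
have [e e0 cst] := pair_right_constant cf cg t0.
have [k1 k1P] := delta_small _ e0; have [k2 k2P] := N_large (t + e).
exists (maxn k1 k2) => k; rewrite geq_max => /andP[/k1P dk /k2P Nk].
have away s : 0 <= s < t + e -> f s != z /\ g s != z.
  move=> /andP[s0 ste]; have [st|ts] := leP s t; first by apply: ok; rewrite s0.
  have ts' : t <= s < t + e by rewrite (ltW ts).
  by have [-> ->] := cst s ts'; apply: ok; rewrite t0 lexx.
(* First grid index strictly after [t]. *)
pose m := (Num.truncn (t / delta k)).+1.
have dk0 := delta_gt0 k.
have /andP[m1 m2] := truncn_itv (divr_ge0 t0 (ltW dk0)).
have tm : t < m%:R * delta k by rewrite -ltr_pdivrMr.
have mt : m%:R * delta k < t + e.
  rewrite /m -natr1 mulrDl mul1r; apply: ler_ltD => //.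
  by rewrite -ler_pdivlMr.
have itv i : (i <= m)%N -> 0 <= i%:R * delta k < t + e.
  move=> im; rewrite mulr_ge0 ?(ltW dk0)//=; apply: le_lt_trans mt.
  by rewrite ler_wpM2r ?(ltW dk0)// ler_nat.
have exj : exists j, f (j%:R * delta k) == g (j%:R * delta k).
  by exists m; have [-> ->] := cst _ (introT andP (conj (ltW tm) mt)); rewrite fgt.
case: (ex_minnP exj) => j /eqP fgj minj.
have jm : (j <= m)%N.
  by apply: minj; have [-> ->] := cst _ (introT andP (conj (ltW tm) mt)); rewrite fgt.
exists j; split=> //.
- have /andP[_ jt] := itv j jm.
  by have := lt_trans jt Nk; rewrite ltr_pM2r// ltr_nat.
- by have [] := away _ (itv j jm).
- move=> i ij; have [? ?] := away _ (itv i (leq_trans (ltnW ij) jm)).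
  split=> //; apply/negP => /minj; by rewrite leqNgt ij.
Qed.

(** By right-continuity a path that reaches [z] stays there for a while, so a fine enough grid sees
    the visit. A grid collision with no earlier grid visit to [z] then precedes every true visit. *)
Lemma skeleton_often_collides f g z (delta : nat -> R) :
  cadlag f -> cadlag g ->
  (forall k, 0 < delta k) ->
  (forall e, 0 < e -> exists k0, forall k, (k0 <= k)%N -> delta k < e) ->
  (forall n, exists k, (n <= k)%N /\ exists j,
    [/\ f (j%:R * delta k) = g (j%:R * delta k), f (j%:R * delta k) != z &
        forall i, (i < j)%N -> f (i%:R * delta k) != z /\
          g (i%:R * delta k) != z]) ->
  exists t, [/\ 0 <= t, f t = g t &
    forall s, 0 <= s <= t -> f s != z /\ g s != z].
Proof.
move=> cf cg delta_gt0 delta_small often.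
pose bad := [set s | 0 <= s /\ ((f s == z) || (g s == z))].
have notbad s : 0 <= s -> ~ bad s -> f s != z /\ g s != z.
  move=> s0 nb; apply/andP; rewrite -negb_or; apply/negP => h; exact: nb.
have grid_ge0 k i : 0 <= i%:R * delta k by rewrite mulr_ge0 ?ler0n ?(ltW (delta_gt0 k)).
have [bad0|/set0P bad_ne] := eqVneq bad set0.
  have [k [_ [j [fg _ _]]]] := often 0.
  exists (j%:R * delta k); split=> // s /andP[s0 _]; apply: notbad => //.
  by rewrite bad0.
have bad_lb : has_lbound bad by exists 0 => s [].
have b0 : 0 <= inf bad by apply: lb_le_inf => // s [].
have before s : 0 <= s -> s < inf bad -> f s != z /\ g s != z.
  move=> s0 sb; apply: notbad => // bs.
  by have := ge_inf bad_lb bs; rewrite leNgt sb.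
have [e e0 cst] := pair_right_constant cf cg b0.
have [s [s0 bs] se] := inf_adherent e0 (conj bad_ne bad_lb).
(* A bad time exists within [e] of the infimum, and both paths are constant on that window, so the
   whole window is bad. *)
have after r : inf bad <= r < inf bad + e -> (f r == z) || (g r == z).
  move=> /cst[-> ->]; have sb : inf bad <= s < inf bad + e by rewrite se andbT; apply: ge_inf.
  by have [<- <-] := cst s sb.
have [k0 k0P] := delta_small _ e0.
have [k [/k0P dk [j [fg fz ok]]]] := often k0.
have [jb|bj] := ltP (j%:R * delta k) (inf bad).
  exists (j%:R * delta k); split=> // r /andP[r0 rj].
  by apply: before => //; apply: le_lt_trans jb.
(* If the collision came after [inf bad], the first grid point [i <= j] past the infimum would lie
   in the bad window: [i < j] contradicts survival, and [i = j] contradicts colliding off [z]. *)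
have exi : exists i, inf bad <= i%:R * delta k by exists j.
case: (ex_minnP exi) => i bi mini.
have ie : i%:R * delta k < inf bad + e.
  case: i bi mini => [|i] bi mini; first by rewrite mul0r ltr_wpDl.
  rewrite -natr1 mulrDl mul1r; apply: ltrD => //.
  by rewrite ltNge; apply/negP => /mini; rewrite ltnn.
have := after _ (introT andP (conj bi ie)).
have : (i <= j)%N by exact: mini.
rewrite leq_eqVlt => /orP[/eqP->|/ok[/negbTE-> /negbTE->]]//.
by rewrite -fg (negbTE fz).
Qed.

End Paths.

(** * Passage to the limit along the meshes [1 / (k + 4)] *)

Theorem theorem1p1 (R : realType) (S : finType) (P : S -> S -> R) (pi : S -> R)
  (d : measure_display) (T : measurableType d) (mu : probability T R)
  (X Y : R -> T -> S) (Z : T -> S) :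
  (1 < #|S|)%N ->
  stochastic P -> irreducible P -> stationary_dist P pi -> reversible P pi ->
  transitive_chain P ->
  (forall t x, measurable [set w | X t w = x]) ->
  (forall t x, measurable [set w | Y t w = x]) ->
  (forall x, measurable [set w | Z w = x]) ->
  (forall w, cadlag (X ^~ w)) -> (forall w, cadlag (Y ^~ w)) ->
  XYZ_law mu P pi X Y Z ->
  ((1 / 4 : R)%:E <=
   mu [set w | (meet_time (X ^~ w) (Y ^~ w) <
                Order.min (meet_time (X ^~ w) (fun=> Z w))
                          (meet_time (Y ^~ w) (fun=> Z w)))%E])%E.
Proof.
move=> S2 stochP irrP statP revP trP mX mY mZ cX cY law.
pose n : R := #|S|%:R.
have n_gt0 : 0 < n by rewrite ltr0n ltnW.
have piE := stationary_uniform stochP (transitive_col_sum stochP trP) irrP statP.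
have {}piE : pi = (fun=> n^-1) by apply/funext.
have symP x y : P x y = P y x.
  have := revP x y; rewrite piE => /mulfI; apply.
  by rewrite invr_neq0// gt_eqF.
have [s [g [g_gt0 s_diag s_sym s_bound [s_sum s_poisson]]]] :=
  hitting_kernel S2 stochP irrP trP symP.
pose M := (Num.truncn (4 * g)).+1.
have gM : 4 * g <= M%:R by rewrite ltW// truncnS_gt.
(* Starting at 4 ensures [delta k <= 1 / 4] for every [k]. *)
pose delta k : R := k.+4%:R^-1.
(* [N k] steps of mesh [delta k] reach time [M * k.+4], and
   [N k * delta k ^+ 2 = M >= 4 g] as optional stopping requires. *)
pose N k := (M * k.+4 * k.+4)%N.
have delta_gt0 k : 0 < delta k by rewrite invr_gt0.
have delta_small e : 0 < e -> exists k0, forall k, (k0 <= k)%N -> delta k < e.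
  move=> e0; exists (Num.truncn e^-1) => k k0k.
  rewrite /delta -[ltRHS]invrK ltf_pV2 ?posrE ?invr_gt0//.
  apply: lt_le_trans (truncnS_gt _) _; rewrite ler_nat.
  by rewrite ltnS; do 3!apply: leqW.
have N_large t : exists k0, forall k, (k0 <= k)%N -> t < (N k)%:R * delta k.
  exists (Num.truncn t) => k k0k; rewrite /N natrM mulfK//.
  apply: lt_le_trans (truncnS_gt _) _; rewrite ler_nat.
  by apply: (@leq_trans k.+4); [rewrite ltnS; do 3!apply: leqW|exact: leq_pmull].
pose F k := skeleton_good X Y Z (delta k) (N k).
have mF k : measurable (F k) by apply: measurable_skeleton_good.
(* A good path is in all but finitely many [F k], and a path in infinitely many [F k] is good. The
   identity also makes the event measurable. *)
have -> : [set w | (meet_time (X ^~ w) (Y ^~ w) <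
                Order.min (meet_time (X ^~ w) (fun=> Z w))
                          (meet_time (Y ^~ w) (fun=> Z w)))%E] = lim_sup_set F.
  apply/seteqP; split=> w /=.
    move=> /(collide_before_trap (Z w) (cX w) (cY w))[t [t0 XYt away]] m _.
    have [k0 k0P] := skeleton_eventually_collides (cX w) (cY w) t0 XYt away
      delta_gt0 delta_small N_large.
    exists (maxn m k0); first exact: leq_maxl.
    have [j [jN XYj XZj ok]] := k0P _ (leq_maxr m k0).
    exists j; split=> //; first by rewrite /collided /= XYj eqxx -XYj.
    by move=> i /ok[h1 h2 h3]; rewrite /stopped !negb_or h1 h2.
  move=> often; apply/(collide_before_trap (Z w) (cX w) (cY w)).
  apply: (skeleton_often_collides (cX w) (cY w) delta_gt0 delta_small) => m.
  have [k mk [j [jN /andP[/eqP XYj XZj] ok]]] := often m I.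
  exists k; split=> //; exists j; split=> // i /ok.
  by rewrite /stopped !negb_or => /and3P[].
pose C := 2 * n * (32 * g + 1).
have C_gt0 : 0 < C by rewrite !mulr_gt0// addr_gt0// mulr_gt0.
have muF k : C * delta k <= 1 -> (((1 - C * delta k) / 4)%:E <= mu (F k))%E.
  move=> Cd; have dk0 := ltW (delta_gt0 k).
  rewrite /F (skeleton_good_law mX mY mZ law dk0) lee_fin piE.
  have -> : (1 - C * delta k) / 4 = \sum_(z : S) n^-1 * ((1 - C * delta k) / 4).
    by rewrite sumr_const -[RHS]mulr_natl mulVKf// gt_eqF.
  apply: ler_sum => z _; apply: ler_wpM2l; first by rewrite invr_ge0 ltW.
  apply: (skeleton_collision stochP.1 _ stochP.2 _ (delta_gt0 k) _ _ (ltnW S2)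
    g_gt0 s_diag s_sym s_bound s_sum s_poisson) => //.
  - exact: heat_ge0.
  - exact: heat_row_sum.
  - by rewrite /delta mul1r lef_pV2 ?posrE// ler_nat.
  - move=> x y; apply: le_trans (heat_ge stochP dk0 x y).
    apply: ler_wpM2r; last exact: expR_ge1Dx.
    by rewrite addr_ge0 ?ler0n// mulr_ge0// stochP.1.
  - by rewrite /N !natrM expr2 mulrA !mulfK.
(* The tail union contains some [F k] whose mesh is fine enough to lose at most [e]. *)
have tail m : ((1 / 4 : R)%:E <= mu (\bigcup_(k >= m) F k))%E.
  apply/lee_addgt0Pr => e e0.
  have e'0 : 0 < Num.min 1 e / C by rewrite divr_gt0// lt_min ltr01.
  have [k0 k0P] := delta_small _ e'0; have := k0P _ (leq_maxr m k0).
  rewrite ltr_pdivlMr// lt_min mulrC => /andP[C1 Ce].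
  apply: (@le_trans _ _ (((1 - C * delta (maxn m k0)) / 4)%:E + e%:E)%E).
    by rewrite lee_fin; lra.
  apply: leeD => //; apply: le_trans (muF _ (ltW C1)) _.
  apply: le_measure; rewrite ?inE//; first exact: bigcup_measurable.
  by apply: bigcup_sup; exact: leq_maxl.
(* Continuity from above along the decreasing tail unions, whose measure is finite. *)
have cvg := lim_sup_set_cvg mu F mF.
have /cvg cvgF : (mu (\bigcup_(k >= 0) F k) < +oo)%E.
  by apply: le_lt_trans (probability_le1 mu _) _; rewrite ?ltry//;
    exact: bigcup_measurable.
rewrite -(cvg_lim _ cvgF)//; apply: lime_ge; last exact: nearW.
by apply/cvg_ex; eexists; exact: cvgF.
Qed.
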